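(* Let $m_1,m_2,n$ be positive integers with $m_1+1=nm_2$ (so $k:=nm_2-m_1=1$). Then the Kronecker MLE exists uniquely for a sample of $n$ generic matrices $Y_1,\dots,Y_n\in\mathbb{R}^{m_1\times m_2}$ if and only if $n\ge m_2$. Moreover, suppose $n\ge m_2$ and let the data be generic. Let $D\in\mathbb{R}^{nm_2}$ be the vector associated with the data (defined in the context), and write $D^\top=[d_1^\top,\ldots,d_n^\top]$ with $d_i\in\mathbb{R}^{m_2}$. Then $$\hat K_2=\sum_{i=1}^n d_id_i^\top$$ is the unique minimizer, up to positive scaling, of $$K\mapsto m_2\log\det\left(D^\top(I_n\otimes K^{-1})D\right)+\log\det(K)$$ over $\mathbb{P}(\mathrm{PD}(m_2))$. Consequently, for this sample size the ML degree is one.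
   Context: $\mathrm{PD}(m)$ denotes the cone of real symmetric positive definite $m\times m$ matrices, and $\mathbb{P}(\mathrm{PD}(m))$ the set of equivalence classes of $\mathrm{PD}(m)$ under multiplication by positive scalars. Kronecker MLE: for $Y_1,\dots,Y_n\in\mathbb{R}^{m_1\times m_2}$, the log-likelihood of the model $\mathrm{vec}(Y_i)\sim\mathcal N(0,\Sigma_2\otimes\Sigma_1)$ i.i.d., in terms of $K_j=\Sigma_j^{-1}\in\mathrm{PD}(m_j)$, is up to constants $$\ell(K_2\otimes K_1)=nm_2\log\det(K_1)+nm_1\log\det(K_2)-\operatorname{tr}\Big(\sum_{i=1}^n K_1Y_iK_2Y_i^\top\Big).$$ The Kronecker MLE is the maximizer of $\ell$ over $\{K_2\otimes K_1:K_j\in\mathrm{PD}(m_j)\}$; it exists uniquely if exactly one matrix $K_2\otimes K_1$ attains the maximum. Genericity: a property of $y\in\mathbb{R}^N$ holds generically if there is a proper algebraic variety $V\subsetneq\mathbb{R}^N$ such that it holds for all $y\in\mathbb{R}^N\setminus V$. The matrix $D$: assume $k:=nm_2-m_1>0$. Concatenate the data as $Y=[Y_1|\cdots|Y_n]\in\mathbb{R}^{m_1\times nm_2}$ and let $Y_*$ be the left-most $m_1\times m_1$ block of $Y$, which is invertible for generic data. Then $Y_*^{-1}Y=[I_{m_1}|C]$ with $C\in\mathbb{R}^{m_1\times k}$, and $D\in\mathbb{R}^{nm_2\times k}$ is defined by $D^\top=[C^\top|-I_k]$. When $k=1$, $D$ is a vector in $\mathbb{R}^{nm_2}$. ML multiplicity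 and ML degree: partition the rows of $D$ into $n$ consecutive blocks of size $m_2$ and let $d_{ij}\in\mathbb{R}^{m_2}$ be the $j$th column of the $i$th block ($i\in[n]$, $j\in[k]$); for $a,b\in[k]$ put $D_{ab}=\sum_{i=1}^n d_{ia}d_{ib}^\top\in\mathbb{R}^{m_2\times m_2}$. The ML multiplicity of the Kronecker MLE problem for the given data is the number of points $[\Sigma]$ in the complex projective space of symmetric complex $m_2\times m_2$ matrices with $\det(\Sigma)\ne0$ and $\det([\operatorname{tr}(D_{ab}\Sigma)]_{a,b\in[k]})\neq0$ that satisfy the likelihood equations $$m_2\det(\Sigma)\sum_{\pi\in\mathcal S_k}\operatorname{sgn}(\pi)\sum_{b=1}^k\Big(\prod_{a\ne b}\operatorname{tr}(D_{a\pi(a)}\Sigma)\Big)D_{b\pi(b)}=k\det\left([\operatorname{tr}(D_{ab}\Sigma)]_{a,b\in[k]}\right)\operatorname{adj}(\Sigma),$$ where $\mathcal S_k$ is the symmetric group and $\operatorname{adj}$ the adjugate. The ML degree equals $d$ if the ML multiplicity equals $d$ for generic $(Y_1,\dots,Y_n)$. *)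

(* Defs.v *)
From HB Require Import structures.
From mathcomp Require Import all_boot all_order all_algebra all_fingroup.
From mathcomp Require Import all_classical all_reals all_analysis.
From mathcomp.real_closed Require Import complex mxtens.
From mathcomp Require mpoly.
Set Implicit Arguments.
Unset Strict Implicit.
Unset Printing Implicit Defensive.
Import Order.TTheory GRing.Theory Num.Theory.
Local Open Scope classical_set_scope.
Local Open Scope ring_scope.

Definition posdef (R : realType) (m : nat) (K : 'M[R]_m) : Prop :=
  K^T = K /\ forall v : 'cV[R]_m, v != 0 -> 0 < (v^T *m K *m v) 0 0.

(* A point of P(PD(m)), as the set of its representatives. *)
Definition pos_ray (R : realType) (m : nat) (K : 'M[R]_m) : set 'M[R]_m :=
  [set L | exists2 c : R, 0 < c & L = c *: K].

(* For f invariant under positive scaling: the minimizers of f over PD(m) form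
   exactly one point of P(PD(m)), namely the class of K0. *)
Definition unique_minimizer_up_to_scaling (R : realType) (m : nat)
    (f : 'M[R]_m -> R) (K0 : 'M[R]_m) : Prop :=
  posdef K0 /\
  [set K | posdef K /\ forall L, posdef L -> f K <= f L] = pos_ray K0.

Definition zero_locus (R : realType) (N : nat)
    (S : set (mpoly.mpoly N R)) : set ('I_N -> R) :=
  [set y | forall p, S p -> mpoly.meval y p = 0].

Definition generically (R : realType) (N : nat) (P : ('I_N -> R) -> Prop) :=
  exists S : set (mpoly.mpoly N R),
    zero_locus S != setT /\ forall y, ~ zero_locus S y -> P y.

Definition sample (R : realType) (n m1 m2 : nat) : Type :=
  'I_n -> 'M[R]_(m1, m2).

Definition sample_of_point (R : realType) (n m1 m2 : nat)
    (y : 'I_(n * (m1 * m2)) -> R) : sample R n m1 m2 :=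
  fun i => \matrix_(r, c) y (mxtens_index (i, mxtens_index (r, c))).

Definition generic_sample (R : realType) (n m1 m2 : nat)
    (P : sample R n m1 m2 -> Prop) : Prop :=
  generically (fun y => P (sample_of_point y)).

Definition loglik (R : realType) (n m1 m2 : nat) (Y : sample R n m1 m2)
    (K1 : 'M[R]_m1) (K2 : 'M[R]_m2) : R :=
  (n * m2)%:R * ln (\det K1) + (n * m1)%:R * ln (\det K2)
    - \tr (\sum_(i < n) K1 *m Y i *m K2 *m (Y i)^T).

(* loglik depends on (K1, K2) only through the Kronecker product K2 *t K1. *)
Definition is_kronecker_mle (R : realType) (n m1 m2 : nat)
    (Y : sample R n m1 m2) (K : 'M[R]_(m2 * m1)) : Prop :=
  exists (K1 : 'M[R]_m1) (K2 : 'M[R]_m2),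
    [/\ posdef K1, posdef K2, K = tensmx K2 K1 &
        forall (L1 : 'M[R]_m1) (L2 : 'M[R]_m2), posdef L1 -> posdef L2 ->
          loglik Y L1 L2 <= loglik Y K1 K2].

Definition kronecker_mle_exists_uniquely (R : realType) (n m1 m2 : nat)
    (Y : sample R n m1 m2) : Prop :=
  exists! K : 'M[R]_(m2 * m1), is_kronecker_mle Y K.

(* [Y_1 | ... | Y_n]: mxtens_index (i, c) = i * m2 + c, so column c of Y_i
   is column i * m2 + c. *)
Definition concat_sample (R : realType) (n m1 m2 : nat)
    (Y : sample R n m1 m2) : 'M[R]_(m1, n * m2) :=
  \matrix_(r, l) Y (mxtens_unindex l).1 r (mxtens_unindex l).2.

(* D^T = [C^T | -I_k], where Ystar^-1 [Y_1 | ... | Y_n] = [I_m1 | C]; only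
   meaningful when Ystar is invertible, which is generically the case. *)
Definition Dmx (R : realType) (n m1 m2 k : nat) (e : (m1 + k = n * m2)%N)
    (Y : sample R n m1 m2) : 'M[R]_(n * m2, k) :=
  let Yc : 'M[R]_(m1, m1 + k) := castmx (erefl, esym e) (concat_sample Y) in
  let Ystar : 'M[R]_m1 := lsubmx Yc in
  let C : 'M[R]_(m1, k) := rsubmx (invmx Ystar *m Yc) in
  castmx (e, erefl) (col_mx C (- 1%:M)).

Definition dvec (R : realType) (n m2 k : nat) (D : 'M[R]_(n * m2, k))
    (i : 'I_n) (j : 'I_k) : 'cV[R]_m2 :=
  \col_r D (mxtens_index (i, r)) j.

Definition objective (R : realType) (n m2 k : nat) (D : 'M[R]_(n * m2, k))
    (K : 'M[R]_m2) : R :=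
  m2%:R * ln (\det (D^T *m tensmx (1%:M : 'M[R]_n) (invmx K) *m D))
    + ln (\det K).

Definition Dblock (R : realType) (n m2 k : nat) (D : 'M[R]_(n * m2, k))
    (a b : 'I_k) : 'M[R]_m2 :=
  \sum_(i < n) dvec D i a *m (dvec D i b)^T.

Definition DblockC (R : realType) (n m2 k : nat) (D : 'M[R]_(n * m2, k))
    (a b : 'I_k) : 'M[R[i]]_m2 :=
  map_mx (real_complex R) (Dblock D a b).

Definition Dtrace (R : realType) (n m2 k : nat) (D : 'M[R]_(n * m2, k))
    (S : 'M[R[i]]_m2) : 'M[R[i]]_k :=
  \matrix_(a, b) \tr (DblockC D a b *m S).

Definition likelihood_equations (R : realType) (n m2 k : nat)
    (D : 'M[R]_(n * m2, k)) (S : 'M[R[i]]_m2) : Prop :=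
  (m2%:R * \det S) *:
    (\sum_(s : 'S_k) (-1) ^+ s *:
       \sum_(b < k) (\prod_(a < k | a != b) \tr (DblockC D a (s a) *m S))
                      *: DblockC D b (s b))
  = (k%:R * \det (Dtrace D S)) *: \adj S.

(* A point of complex projective space, as the set of its representatives. *)
Definition proj_class (R : realType) (m : nat) (S : 'M[R[i]]_m) :
    set 'M[R[i]]_m :=
  [set T | exists2 c : R[i], c != 0 & T = c *: S].

Definition ml_points (R : realType) (n m2 k : nat) (D : 'M[R]_(n * m2, k)) :
    set (set 'M[R[i]]_m2) :=
  [set proj_class S | S in
    [set S : 'M[R[i]]_m2 | [/\ S^T = S, S != 0, \det S != 0,
                               \det (Dtrace D S) != 0 &
                               likelihood_equations D S]]].

Definition ml_multiplicity_eq (R : realType) (n m1 m2 k : nat)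
    (e : (m1 + k = n * m2)%N) (Y : sample R n m1 m2) (d : nat) : Prop :=
  (ml_points (Dmx e Y) #= `I_d)%card.

Definition ml_degree_eq (R : realType) (n m1 m2 k : nat)
    (e : (m1 + k = n * m2)%N) (d : nat) : Prop :=
  generic_sample (fun Y : sample R n m1 m2 => ml_multiplicity_eq e Y d).

(* Main.v *)
(* Fix K2. The log-likelihood is concave in K1, with maximizer
   n m2 (Y (I (x) K2) Y^T)^-1 where Y = [Y_1 | ... | Y_n]. As Y has corank one
   with kernel spanned by D, one has
     det (Y A Y^T) = c (D^T A^-1 D) det A   for A positive definite,
   so the profile log-likelihood is a constant minus n times
     f(K2) = m2 log tr (S K2^-1) + log det K2,   S = sum_i d_i d_i^T.
   If S is positive definite, which for n >= m2 is a polynomial condition on the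
   data, AM-GM for the eigenvalues of S K2^-1 shows that f is minimal exactly
   on the ray of S. If n < m2, some v is orthogonal to all the d_i, and replacing
   K2^-1 by K2^-1 + v v^T decreases f, so that no sample has an MLE. The
   likelihood equations for k = 1 say that S Sigma is a scalar matrix. *)
Require Import Defs.
From mathcomp Require Import all_boot all_order all_algebra.
From mathcomp Require Import all_classical all_reals all_analysis.
From mathcomp Require Import fingroup perm ring lra.
From mathcomp.real_closed Require Import complex mxtens.
From mathcomp Require mpoly.
Import -(notations) mpoly.
Import Order.TTheory GRing.Theory Num.Theory.
Local Open Scope ring_scope.

Set Implicit Arguments.
Unset Strict Implicit.
Unset Printing Implicit Defensive.

(** * Positive definite matrices *)

Lemma cVnorm_ge0 (R : realType) m (v : 'cV[R]_m) : 0 <= (v^T *m v) 0 0.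
Proof. by rewrite mxE sumr_ge0 // => i _; rewrite mxE -expr2 sqr_ge0. Qed.

Lemma cVnorm_eq0 (R : realType) m (v : 'cV[R]_m) :
  (v^T *m v) 0 0 = 0 -> v = 0.
Proof.
rewrite mxE => /eqP; rewrite psumr_eq0; last first.
  by move=> i _; rewrite mxE -expr2 sqr_ge0.
move=> /allP h; apply/matrixP=> i j; rewrite mxE ord1.
by have := h i (mem_index_enum _); rewrite mxE mulf_eq0 orbb => /eqP.
Qed.

Lemma cVnorm_gt0 (R : realType) m (v : 'cV[R]_m) :
  v != 0 -> 0 < (v^T *m v) 0 0.
Proof.
move=> v0; rewrite lt_neqAle cVnorm_ge0 andbT eq_sym.
by apply: contra v0 => /eqP /cVnorm_eq0 ->.
Qed.

Lemma posdef1 (R : realType) m : posdef (1%:M : 'M[R]_m).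
Proof. by split=> [|v /cVnorm_gt0]; rewrite ?trmx1 ?mulmx1. Qed.

Lemma posdef_congr (R : realType) m p (A : 'M[R]_m) (X : 'M[R]_(m, p)) :
  posdef A -> (forall v : 'cV_p, X *m v = 0 -> v = 0) ->
  posdef (X^T *m A *m X).
Proof.
move=> [symA posA] injX; split=> [|v v0].
  by rewrite !trmx_mul trmxK symA mulmxA.
have := posA (X *m v); rewrite trmx_mul !mulmxA; apply.
by apply: contra v0 => /eqP /injX ->.
Qed.

Lemma posdef_congr_unit (R : realType) m (A X : 'M[R]_m) :
  posdef A -> X \in unitmx -> posdef (X^T *m A *m X).
Proof.
move=> pA uX; apply: posdef_congr => // v Xv0.
by rewrite -[v](mulKmx uX) Xv0 mulmx0.
Qed.

Lemma posdefD (R : realType) m (A B : 'M[R]_m) :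
  posdef A -> B^T = B -> (forall v : 'cV_m, 0 <= (v^T *m B *m v) 0 0) ->
  posdef (A + B).
Proof.
move=> [sA pA] sB pB; split=> [|v v0]; first by rewrite linearD /= sA sB.
by rewrite mulmxDr mulmxDl mxE ltr_wpDr // pA.
Qed.

Lemma posdefZ (R : realType) m (c : R) (A : 'M[R]_m) :
  0 < c -> posdef A -> posdef (c *: A).
Proof.
move=> c0 [sA pA]; split=> [|v v0]; first by rewrite linearZ /= sA.
by rewrite -scalemxAr -scalemxAl mxE mulr_gt0 // pA.
Qed.

(** One step of symmetric elimination: [a] is the pivot, [b] the rest of the first row divided by
    it, and the Schur complement [Z] is positive definite as the congruence of [X] by the injective
    block column [(-b; 1)]. *)
Lemma posdef_schur (R : realType) m (X : 'M[R]_(1 + m)) : posdef X ->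
  exists (a : R) (b : 'rV[R]_m) (Z : 'M[R]_m),
    [/\ 0 < a, posdef Z &
     X = (block_mx 1%:M b 0 1%:M)^T *m block_mx a%:M 0 0 Z
           *m block_mx 1%:M b 0 1%:M].
Proof.
move=> pX; have [sX qX] := pX.
pose a := X 0 0.
have sub_ul : ulsubmx X = a%:M.
  by rewrite [LHS]mx11_scalar !mxE /a; congr ((X _ _)%:M); exact: val_inj.
have sub_dl : dlsubmx X = (ursubmx X)^T by rewrite -[X in dlsubmx X]sX -trmx_ursub.
have a0 : 0 < a.
  have := qX (delta_mx 0 0).
  rewrite trmx_delta -rowE -colE !mxE; apply.
  by apply/eqP=> /matrixP /(_ 0 0); rewrite !mxE /= => /eqP; rewrite oner_eq0.
have [b ur] : exists b : 'rV_m, ursubmx X = a *: b.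
  by exists (a^-1 *: ursubmx X); rewrite scalerA divff ?scale1r ?gt_eqF.
have [Z dr] : exists Z, drsubmx X = a *: (b^T *m b) + Z.
  by exists (drsubmx X - a *: (b^T *m b)); rewrite addrC subrK.
have eX : X = block_mx a%:M (a *: b) (a *: b^T) (a *: (b^T *m b) + Z).
  by rewrite -[LHS]submxK sub_ul sub_dl ur linearZ dr.
have dec : X = (block_mx 1%:M b 0 1%:M)^T *m block_mx a%:M 0 0 Z
           *m block_mx 1%:M b 0 1%:M.
  rewrite tr_block_mx !trmx1 trmx0 !mulmx_block !mul1mx !mulmx0 !mul0mx.
  by rewrite !mulmx1 !addr0 !add0r mul_scalar_mx mul_mx_scalar -scalemxAl.
exists a, b, Z; split=> //.
have -> : Z = (col_mx (- b) 1%:M)^T *m X *m col_mx (- b) 1%:M.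
  rewrite eX tr_col_mx mul_row_block mul_row_col !trmx1 !mul1mx.
  have -> : (- b)^T = - b^T by exact: linearN.
  rewrite mul_mx_scalar scalerN addNr mul0mx add0r mulmx1.
  by rewrite mulNmx -scalemxAr addrA addNr add0r.
apply: posdef_congr => // v; rewrite mul_col_mx mul1mx => /matrixP h.
by apply/matrixP=> i j; have := h (rshift 1 i) j; rewrite col_mxEd !mxE.
Qed.

(** Induction on the size through the Schur complement, taking the square root of each pivot. *)
Lemma posdef_cholesky (R : realType) m (X : 'M[R]_m) : posdef X ->
  exists2 L : 'M[R]_m, L \in unitmx & X = L^T *m L.
Proof.
elim: m X => [|m IH] X pX.
  by exists 1%:M; rewrite ?unitmx1 //; apply/matrixP=> -[].
change ('M[R]_(1 + m)) in X.
suff: exists2 L : 'M[R]_(1 + m), L \in unitmx & X = L^T *m L by [].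
have [a [b [Z [a0 /IH [L uL eZ] ->]]]] := posdef_schur pX.
exists (block_mx (Num.sqrt a)%:M 0 0 L *m block_mx 1%:M b 0 1%:M).
  rewrite unitmx_mul !unitmxE (@det_ublock _ 1) (@det_ublock _ 1) !det1.
  rewrite mulr1 unitr1 andbT det_scalar1 unitrM -unitmxE uL andbT.
  by rewrite unitfE gt_eqF ?sqrtr_gt0.
rewrite [in RHS]trmx_mul -!mulmxA; congr (_ *m _); rewrite mulmxA.
congr (_ *m _); rewrite tr_block_mx !trmx0 tr_scalar_mx mulmx_block.
by rewrite !mulmx0 !mul0mx !addr0 !add0r -scalar_mxM -expr2 sqr_sqrtr ?ltW // eZ.
Qed.

Lemma posdef_gram (R : realType) m (L : 'M[R]_m) :
  L \in unitmx -> posdef (L^T *m L).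
Proof. by move/(posdef_congr_unit (posdef1 R m)); rewrite mulmx1. Qed.

Lemma posdef_det_gt0 (R : realType) m (X : 'M[R]_m) : posdef X -> 0 < \det X.
Proof.
move=> /posdef_cholesky [L uL ->]; rewrite det_mulmx det_tr -expr2.
by rewrite lt_neqAle sqr_ge0 andbT eq_sym sqrf_eq0 -unitfE -unitmxE.
Qed.

Lemma posdef_unit (R : realType) m (X : 'M[R]_m) : posdef X -> X \in unitmx.
Proof. by move=> /posdef_det_gt0 h; rewrite unitmxE unitfE gt_eqF. Qed.

Lemma posdef_inv (R : realType) m (X : 'M[R]_m) :
  posdef X -> posdef (invmx X).
Proof.
move=> pX; have uX := posdef_unit pX; have [sX _] := pX.
have uV : invmx X \in unitmx by rewrite unitmx_inv.
have := posdef_congr_unit pX uV.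
by rewrite trmx_inv sX mulVmx // mul1mx.
Qed.

Lemma posdef_tens1 (R : realType) n m (X : 'M[R]_m) :
  posdef X -> posdef (tensmx (1%:M : 'M[R]_n) X).
Proof.
(* Empty matrices are vacuously positive definite. With them set aside, [I (x) L] is an invertible
   factor of nonempty size and the product is its Gram matrix. *)
case: n => [|n].
  by split; [apply/matrixP=> -[] | move=> v; rewrite flatmx0 eqxx].
case: m X => [|m] X pX.
  have h k : k = 0%N -> forall A : 'M[R]_k, posdef A.
    by move=> ->; split; [apply/matrixP=> -[] | move=> v; rewrite flatmx0 eqxx].
  by apply: h; rewrite muln0.
have [L uL ->] := posdef_cholesky pX.
have -> : tensmx (1%:M : 'M[R]_n.+1) (L^T *m L)
    = (tensmx (1%:M : 'M[R]_n.+1) L)^T *m tensmx (1%:M : 'M[R]_n.+1) L.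
  by rewrite trmx_tens tensmx_mul trmx1 mul1mx.
by apply: posdef_gram; apply: tensmx_unit; rewrite ?unitmx1.
Qed.

(** * The log-determinant bounded by the trace *)

Lemma ln_le_subr1 (R : realType) (x : R) : 0 < x -> ln x <= x - 1.
Proof. by move=> x0; rewrite -{1}[x](subrK 1) addrC le_ln1Dx //; lra. Qed.

(** The inequality [1 + t < expR t] is strict for nonzero [t]; it is used at [t = ln x]. *)
Lemma ln_eq_subr1 (R : realType) (x : R) : 0 < x -> ln x = x - 1 -> x = 1.
Proof.
move=> x0 e; have := @expR_gt1Dx R (ln x); rewrite lnK // e.
case: eqP => [h _|_ /(_ isT)]; lra.
Qed.

(** AM-GM for the eigenvalues, without diagonalization. In Schur form the determinant is
    [a * \det Z] and the trace is [a + a |b|^2 + \tr Z], so the scalar inequality for the pivot and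
    induction for [Z] suffice; equality forces [a = 1], [Z = 1] and [b = 0]. *)
Lemma ln_det_le_trace (R : realType) m (X : 'M[R]_m) : posdef X ->
  ln (\det X) <= \tr X - m%:R /\ (ln (\det X) = \tr X - m%:R -> X = 1%:M).
Proof.
elim: m X => [|m IH] X pX.
  rewrite det_mx00 ln1 [\tr X]big_ord0 subr0; split=> // _.
  by apply/matrixP=> -[].
change ('M[R]_(1 + m)) in X.
have [a [b [Z [a0 pZ eX]]]] := posdef_schur pX.
have [leZ eqZ] := IH Z pZ.
have lea := ln_le_subr1 a0; have eqa := @ln_eq_subr1 R a a0.
have dZ := posdef_det_gt0 pZ.
have -> : ln (\det X) = ln a + ln (\det Z).
  rewrite eX !det_mulmx det_tr !(@det_ublock _ 1) !det1 det_scalar1.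
  by rewrite !mulr1 !mul1r lnM.
have eX' : X = block_mx a%:M (a *: b) (a *: b^T) (a *: (b^T *m b) + Z).
  rewrite eX tr_block_mx !trmx1 trmx0 !mulmx_block !mul1mx !mulmx0 !mul0mx.
  by rewrite !mulmx1 !addr0 !add0r mul_scalar_mx mul_mx_scalar -scalemxAl.
have nb : 0 <= (b *m b^T) 0 0 by have := cVnorm_ge0 b^T; rewrite trmxK.
have -> : \tr X = a + a * (b *m b^T) 0 0 + \tr Z.
  rewrite eX' (@mxtrace_block _ 1) mxtrace_scalar mxtraceD mxtraceZ mxtrace_mulC.
  by rewrite trace_mx11 addrA.
have nb' : 0 <= a * (b *m b^T) 0 0 by rewrite mulr_ge0 // ltW.
rewrite -natr1; split; first lra.
move=> eqX.
have a1 : a = 1 by apply: eqa; lra.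
have Z1 : Z = 1%:M by apply: eqZ; lra.
have b0 : b = 0.
  apply: trmx_inj; rewrite trmx0; apply: cVnorm_eq0; rewrite trmxK.
  by move: eqX nb; rewrite a1 ln1; lra.
by rewrite eX' a1 Z1 b0 trmx0 mul0mx !scaler0 add0r -scalar_mx_block.
Qed.

(* Writing P = L^T L, the product P Q is similar to the positive definite L Q L^T. *)
Lemma ln_detM_le_trace (R : realType) m (P Q : 'M[R]_m) :
  posdef P -> posdef Q ->
  ln (\det (P *m Q)) <= \tr (P *m Q) - m%:R
  /\ (ln (\det (P *m Q)) = \tr (P *m Q) - m%:R -> P *m Q = 1%:M).
Proof.
move=> /posdef_cholesky [L uL ->] pQ.
have uLT : L^T \in unitmx by rewrite unitmx_tr.
have := posdef_congr_unit pQ uLT; rewrite trmxK => /ln_det_le_trace.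
have -> : \tr (L *m Q *m L^T) = \tr (L^T *m L *m Q).
  by rewrite mxtrace_mulC mulmxA.
have -> : \det (L *m Q *m L^T) = \det (L^T *m L *m Q).
  by rewrite !det_mulmx mulrC mulrA.
move=> [le eq]; split=> // /eq h.
have -> : Q = invmx L *m invmx L^T.
  by rewrite -[LHS](mulKmx uL) -[L *m Q](mulmxK uLT) h mul1mx.
by rewrite mulmxA mulmxK // mulmxV.
Qed.

(** * The profile likelihood *)

Lemma big_mxtens (V : nmodType) n m (F : 'I_(n * m) -> V) :
  \sum_l F l = \sum_i \sum_c F (mxtens_index (i, c)).
Proof.
rewrite (reindex (@mxtens_index n m)) /=; last first.
  by exists (@mxtens_unindex n m) => l _; rewrite ?mxtens_indexK ?mxtens_unindexK.
by rewrite pair_bigA; apply: eq_bigr => -[].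
Qed.

(** [I_n (x) M] is block diagonal with [n] copies of [M]. Both the trace term of the likelihood and
    the quadratic form of [D] are computed this way. *)
Lemma mulmx_tens1 (R : comPzRingType) n m p q (X : 'M[R]_(p, n * m))
    (M : 'M[R]_m) (W : 'M[R]_(n * m, q)) :
  X *m tensmx (1%:M : 'M[R]_n) M *m W =
  \sum_i (\matrix_(r, c) X r (mxtens_index (i, c))) *m M
          *m (\matrix_(c, s) W (mxtens_index (i, c)) s).
Proof.
apply/matrixP=> r s; rewrite mxE big_mxtens summxE; apply: eq_bigr => i _.
rewrite [RHS]mxE; apply: eq_bigr => c _; congr (_ * _); last by rewrite mxE.
rewrite [LHS]mxE [RHS]mxE big_mxtens (bigD1 i) //=.
rewrite [X in _ + X]big1 ?addr0 => [|j ji].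
  by apply: eq_bigr => d _; rewrite tensmxE !mxE eqxx mul1r.
by apply: big1 => d _; rewrite tensmxE !mxE (negPf ji) mul0r mulr0.
Qed.

(** Each summand [d_i^T M d_i] is a trace, by cyclicity; hence the objective depends on [D] only
    through [S = Dblock D 0 0]. *)
Lemma quad_tens1E (R : realType) n m (D : 'M[R]_(n * m, 1)) (M : 'M[R]_m) :
  (D^T *m tensmx (1%:M : 'M[R]_n) M *m D) 0 0 = \tr (Dblock D 0 0 *m M).
Proof.
rewrite mulmx_tens1 summxE mulmx_suml raddf_sum; apply: eq_bigr => i _ /=.
rewrite -[in RHS]mulmxA [in RHS]mxtrace_mulC trace_mx11.
by congr ((_ *m _ *m _) _ _); apply/matrixP=> r s; rewrite !mxE ?ord1.
Qed.

(** This is the sum of the [Y_i K2 Y_i^T], put in the form to which [det_congr_kernel] applies. *)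
Definition scatter (R : realType) n m1 m2 (Y : sample R n m1 m2)
    (K2 : 'M[R]_m2) : 'M[R]_m1 :=
  concat_sample Y *m tensmx (1%:M : 'M[R]_n) K2 *m (concat_sample Y)^T.

Lemma loglikE (R : realType) n m1 m2 (Y : sample R n m1 m2)
    (K1 : 'M[R]_m1) (K2 : 'M[R]_m2) :
  loglik Y K1 K2 = (n * m2)%:R * ln (\det K1) + (n * m1)%:R * ln (\det K2)
    - \tr (K1 *m scatter Y K2).
Proof.
rewrite /loglik /scatter mulmx_tens1 mulmx_sumr; congr (_ - \tr _).
apply: eq_bigr => i _; rewrite !mulmxA; congr (K1 *m _ *m K2 *m _).
  by apply/matrixP=> r s; rewrite !mxE mxtens_indexK.
by apply/matrixP=> r s; rewrite !mxE mxtens_indexK.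
Qed.

Lemma det_castmx (R : comNzRingType) m m' (e : m = m') (A : 'M[R]_m) :
  \det (castmx (e, e) A) = \det A.
Proof. by case: m' / e; rewrite castmx_id. Qed.

Lemma det_tens1 (R : comNzRingType) n m (M : 'M[R]_m) :
  \det (tensmx (1%:M : 'M[R]_n) M) = \det M ^+ n.
Proof.
elim: n => [|n IH]; first by rewrite det_mx00 expr0.
rewrite (@scalar_mx_block _ 1 n) tens_block_mx.
rewrite !tens0mx det_castmx det_ublock IH exprS tens_scalar1mx.
by rewrite det_castmx.
Qed.

Lemma invmx_tens1 (R : comUnitRingType) n m (M : 'M[R]_m) : M \in unitmx ->
  invmx (tensmx (1%:M : 'M[R]_n) M) = tensmx (1%:M : 'M[R]_n) (invmx M).
Proof.
move=> uM.
have u : tensmx (1%:M : 'M[R]_n) M \in unitmx.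
  by rewrite unitmxE det_tens1 unitrX.
apply: (can_inj (mulKmx u)); rewrite mulmxV // tensmx_mul mulmxV // mul1mx.
apply/matrixP=> i j; case: (mxtens_indexP i) => i0 i1.
case: (mxtens_indexP j) => j0 j1; rewrite tensmxE !mxE.
rewrite (can_eq (@mxtens_indexK n m)) xpair_eqE.
by case: (i0 == j0); case: (i1 == j1); rewrite ?mulr1 ?mulr0.
Qed.

Lemma posdef_row_free (R : realType) p N (Y : 'M[R]_(p, N)) (A : 'M[R]_N) :
  row_free Y -> posdef A -> posdef (Y *m A *m Y^T).
Proof.
move=> fY pA; rewrite -{1}[Y]trmxK; apply: posdef_congr => // v h.
apply: trmx_inj; apply: (row_free_inj fY).
by apply: trmx_inj; rewrite trmx_mul trmxK h !trmx0 mul0mx trmx0.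
Qed.

(* The square matrices [Y; D^T A^-1] and [Y^T | D] turn the quadratic form A
   and the standard one, respectively, into block diagonal ones; comparing
   their determinants with that of their product gives the identity. *)
Lemma det_congr_kernel (R : realType) p N (e : (p + 1 = N)%N)
    (Y : 'M[R]_(p, N)) (D : 'M[R]_(N, 1)) (A : 'M[R]_N) :
  row_free Y -> Y *m D = 0 -> D != 0 -> posdef A ->
  \det (Y *m A *m Y^T) =
  \det (Y *m Y^T) / (D^T *m D) 0 0 * ((D^T *m invmx A *m D) 0 0 * \det A).
Proof.
case: N / e Y D A => Y D A fY YD0 D0 pA.
have [sA _] := pA; have uA := posdef_unit pA.
have DY0 : D^T *m Y^T = 0 by rewrite -trmx_mul YD0 trmx0.
have g0 : 0 < \det (Y *m Y^T).
  apply: posdef_det_gt0; rewrite -[Y in Y *m _]mulmx1.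
  exact: posdef_row_free (posdef1 R _).
have d0 := cVnorm_gt0 D0.
have q0 : 0 < (D^T *m invmx A *m D) 0 0.
  by have [_ h] := posdef_inv pA; apply: h.
set q := (D^T *m invmx A *m D) 0 0 in q0 *.
set d := (D^T *m D) 0 0 in d0 *; set g := \det (Y *m Y^T) in g0 *.
set z := \det (Y *m A *m Y^T).
pose M := col_mx Y (D^T *m invmx A); pose E := row_mx Y^T D.
have e1 : \det M * \det A * \det M = z * q.
  rewrite -[in X in _ * X]det_tr -!det_mulmx /M tr_col_mx trmx_mul trmxK.
  rewrite trmx_inv sA.
  rewrite mul_col_mx mul_col_row -[D^T *m invmx A *m A]mulmxA mulVmx // mulmx1.
  rewrite -(mulmxA Y A (invmx A *m D)) mulKVmx // YD0 DY0 det_ublock mulmxA.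
  by rewrite [X in _ * \det X]mx11_scalar det_scalar1.
(* [M *m E] is only block triangular, as [Y D = 0], but that determines its determinant. *)
have e2 : \det M * \det E = g * q.
  rewrite -det_mulmx mul_col_row YD0 det_lblock.
  by rewrite [X in _ * \det X]mx11_scalar det_scalar1.
have e3 : \det E * \det E = g * d.
  rewrite -[in X in X * _]det_tr -det_mulmx /E tr_row_mx trmxK mul_col_row.
  by rewrite YD0 DY0 det_ublock [X in _ * \det X]mx11_scalar det_scalar1.
have e4 : z * d = g * (q * \det A).
  have gq0 : g * q != 0 by rewrite gt_eqF ?mulr_gt0.
  apply: (mulfI gq0); have -> : g * q * (z * d) = (z * q) * (g * d) by ring.
  rewrite -e1 -e3.
  have -> : g * q * (g * (q * \det A)) = (g * q) * (g * q) * \det A by ring.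
  by rewrite -e2; ring.
by rewrite mulrAC -e4 mulfK // gt_eqF.
Qed.

(** * Maximizing the log-likelihood over [K1] *)

Section Profile.
Variables (R : realType) (n m1 m2 : nat) (e : (m1 + 1 = n * m2)%N).
Variables (n_gt0 : (0 < n)%N) (m2_gt0 : (0 < m2)%N).
Variables (Y : sample R n m1 m2) (D : 'M[R]_(n * m2, 1)).
Hypotheses (freeY : row_free (concat_sample Y)).
Hypotheses (YD0 : concat_sample Y *m D = 0) (D_neq0 : D != 0).

Lemma scatter_posdef K2 : posdef K2 -> posdef (scatter Y K2).
Proof. by move/(posdef_tens1 n)/(posdef_row_free freeY). Qed.

Lemma quad_gt0 K2 : posdef K2 -> 0 < \tr (Dblock D 0 0 *m invmx K2).
Proof.
move=> pK; rewrite -quad_tens1E.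
by have [_ h] := posdef_tens1 n (posdef_inv pK); apply: h.
Qed.

Lemma objectiveE K2 : objective D K2 =
  m2%:R * ln (\tr (Dblock D 0 0 *m invmx K2)) + ln (\det K2).
Proof. by rewrite /objective [X in \det X]mx11_scalar det_scalar1 quad_tens1E. Qed.

(** The first term comes from the trace bound; the second collects the normalization of the scatter
    matrix by [n m2] and the constant factor of [det_congr_kernel]. *)
Definition profile_const : R :=
  - ((n * m2)%:R * m1%:R)
  - (n * m2)%:R * ln ((n * m2)%:R^-1 ^+ m1 *
      (\det (concat_sample Y *m (concat_sample Y)^T) / (D^T *m D) 0 0)).

(** With [N = n m2], the difference of the two sides is exactly [N] times the gap in
    [ln_detM_le_trace] for [K1] and [N^-1 *: scatter Y K2], so equality means that these two are
    inverse to each other. *)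
Lemma loglik_le_profile K1 K2 : posdef K1 -> posdef K2 ->
  loglik Y K1 K2 <= profile_const - n%:R * objective D K2 /\
  (loglik Y K1 K2 = profile_const - n%:R * objective D K2 <->
   K1 = (n * m2)%:R *: invmx (scatter Y K2)).
Proof.
move=> p1 p2.
have pB := scatter_posdef p2.
have N0 : 0 < (n * m2)%:R :> R by rewrite ltr0n muln_gt0 n_gt0.
have Ni0 : 0 < (n * m2)%:R^-1 :> R by rewrite invr_gt0.
rewrite loglikE objectiveE /profile_const (natrM _ n m1).
have eNm : n%:R * m2%:R = (n * m2)%:R :> R by rewrite natrM.
(* Here [m1 + 1 = n m2] enters: the coefficient [N n] of [ln (\det K2)] splits into [n m1] from the
   likelihood and [n] from the objective. *)
have eNn : (n * m2)%:R * n%:R = n%:R * m1%:R + n%:R :> R.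
  by rewrite -e natrD mulrDl mul1r mulrC.
set N : R := (n * m2)%:R in N0 Ni0 eNm eNn *; clearbody N.
have pQ := posdefZ Ni0 pB.
have [le eq] := ln_detM_le_trace p1 pQ.
have d1 := posdef_det_gt0 p1; have d2 := posdef_det_gt0 p2.
have q0 := quad_gt0 p2; have dB := posdef_det_gt0 pB.
have pT := posdef_tens1 n p2.
have kap : 0 < \det (concat_sample Y *m (concat_sample Y)^T) / (D^T *m D) 0 0.
  rewrite divr_gt0 ?cVnorm_gt0 //; apply: posdef_det_gt0.
  by rewrite -[X in X *m _]mulmx1; apply: posdef_row_free (posdef1 R _).
have kk := mulr_gt0 (exprn_gt0 m1 Ni0) kap.
have qd := mulr_gt0 q0 (exprn_gt0 n d2).
have eB : ln (\det (K1 *m (N^-1 *: scatter Y K2))) = ln (\det K1)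
    + (ln (N^-1 ^+ m1 *
        (\det (concat_sample Y *m (concat_sample Y)^T) / (D^T *m D) 0 0))
    + (ln (\tr (Dblock D 0 0 *m invmx K2)) + n%:R * ln (\det K2))).
  rewrite det_mulmx detZ lnM ?posrE ?mulr_gt0 ?exprn_gt0 //; congr (_ + _).
  rewrite (det_congr_kernel e freeY YD0 D_neq0 pT) invmx_tens1 ?posdef_unit //.
  rewrite quad_tens1E det_tens1 mulrA lnM ?posrE //; congr (_ + _).
  by rewrite lnM ?posrE ?exprn_gt0 // lnXn // mulr_natl.
have eT : \tr (K1 *m (N^-1 *: scatter Y K2)) = N^-1 * \tr (K1 *m scatter Y K2).
  by rewrite -scalemxAr mxtraceZ.
set T := \tr (K1 *m scatter Y K2) in eT *.
move: le eq; rewrite eB eT.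
set c := ln (_ * (_ / _)); set l1 := ln (\det K1); set l2 := ln (\det K2).
set t := ln (\tr _) => le eq.
have -> : n%:R * (m2%:R * t + l2) = N * t + n%:R * l2.
  by rewrite mulrDr mulrA eNm.
have gap : N * (N^-1 * T - m1%:R - (l1 + (c + (t + n%:R * l2))))
   = T - N * m1%:R - N * l1 - N * c - N * t - (N * n%:R) * l2.
  by field; rewrite gt_eqF.
rewrite eNn in gap; split.
  have : 0 <= N * (N^-1 * T - m1%:R - (l1 + (c + (t + n%:R * l2)))).
    by apply: mulr_ge0; [exact: ltW | lra].
  by rewrite gap; lra.
split=> [h|h].
  have : l1 + (c + (t + n%:R * l2)) = N^-1 * T - m1%:R.
    have : N * (N^-1 * T - m1%:R - (l1 + (c + (t + n%:R * l2)))) = 0.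
      by rewrite gap; lra.
    by move/eqP; rewrite mulf_eq0 gt_eqF //= => /eqP; lra.
  have N1 : N / N = 1 by rewrite mulfV // gt_eqF.
  move/eq; rewrite -scalemxAr => h2.
  rewrite -[LHS](mulmxK (posdef_unit pB)) -[K1 *m _]scale1r -N1 -scalerA h2.
  by rewrite -scalemxAl mul1mx.
(* Conversely, for this [K1] the product with the normalized scatter matrix is the identity, and the
   gap vanishes. *)
have hT : T = N * m1%:R.
  rewrite /T h -scalemxAl mulVmx ?posdef_unit // mxtraceZ mxtrace_scalar.
  by [].
have : l1 + ln (\det (N^-1 *: scatter Y K2)) = 0.
  rewrite -lnM ?posrE ?posdef_det_gt0 // -det_mulmx h -scalemxAl -scalemxAr.
  by rewrite scalerA mulfV ?gt_eqF // scale1r mulVmx ?posdef_unit // det1 ln1.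
have := eB; rewrite det_mulmx lnM ?posrE ?posdef_det_gt0 // -/l1 -/l2 -/t -/c.
move=> -> hl.
have : N * (N^-1 * T - m1%:R - (l1 + (c + (t + n%:R * l2)))) = 0.
  by rewrite hl hT; field; rewrite gt_eqF.
by rewrite gap; lra.
Qed.
End Profile.

(** * Minimizing the profile objective over [K2] *)

(** Put [t = \tr (S K^-1)] and rescale [K^-1] by [m / t], so that its product with [S] has trace
    [m]. Then [ln_detM_le_trace] says that this product has nonpositive log-determinant, which is
    the claim; equality gives [K = (m / t) S]. *)
Lemma objective_ge (R : realType) n m (D : 'M[R]_(n * m, 1)) (K : 'M[R]_m) :
  (0 < m)%N -> D != 0 -> posdef (Dblock D 0 0) -> posdef K ->
  objective D (Dblock D 0 0) <= objective D K /\
  (objective D K = objective D (Dblock D 0 0) <-> pos_ray (Dblock D 0 0) K).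
Proof.
move=> m_gt0 D0 pS pK; rewrite !objectiveE.
set S := Dblock D 0 0 in pS *.
have mR : 0 < m%:R :> R by rewrite ltr0n.
have tS : \tr (S *m invmx S) = m%:R.
  by rewrite mulmxV ?posdef_unit // mxtrace1.
rewrite tS.
have t0 : 0 < \tr (S *m invmx K) := quad_gt0 D0 pK.
set t := \tr (S *m invmx K) in t0 *.
have c0 : 0 < m%:R / t by rewrite divr_gt0.
have dK := posdef_det_gt0 pK; have dS := posdef_det_gt0 pS.
have [le eq] := ln_detM_le_trace pS (posdefZ c0 (posdef_inv pK)).
have trE : \tr (S *m (m%:R / t *: invmx K)) = m%:R.
  by rewrite -scalemxAr mxtraceZ -/t divfK // gt_eqF.
have lnE : ln (\det (S *m (m%:R / t *: invmx K)))
    = ln (\det S) + (m%:R * (ln m%:R - ln t) - ln (\det K)).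
  rewrite det_mulmx detZ lnM ?posrE //; last first.
    by rewrite mulr_gt0 ?exprn_gt0 // posdef_det_gt0 //; apply: posdef_inv.
  rewrite det_inv lnM ?posrE ?exprn_gt0 ?invr_gt0 // lnV ?posrE //.
  by rewrite lnXn // ln_div ?posrE // mulr_natl.
move: le eq; rewrite lnE trE => le eq; split; first by lra.
split=> [h|[c c_gt0 eK]].
  have h2 : S *m (m%:R / t *: invmx K) = 1%:M by apply: eq; lra.
  exists (m%:R / t) => //.
  by rewrite -[LHS]mul1mx -h2 -scalemxAr -scalemxAl mulmxKV // posdef_unit.
have -> : t = c^-1 * m%:R.
  have iK : invmx K = c^-1 *: invmx S by rewrite eK invmxZ -?eK ?posdef_unit.
  by rewrite /t iK -scalemxAr mxtraceZ tS.
rewrite eK detZ !lnM ?posrE ?invr_gt0 ?exprn_gt0 // lnV ?posrE // lnXn //.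
by rewrite -mulr_natl; ring.
Qed.

Lemma unique_minimizer_Dblock (R : realType) n m (D : 'M[R]_(n * m, 1)) :
  (0 < m)%N -> D != 0 -> posdef (Dblock D 0 0) ->
  unique_minimizer_up_to_scaling (objective D) (Dblock D 0 0).
Proof.
move=> m_gt0 D0 pS; split=> //; apply/seteqP; split=> [K [pK minK]|K rK] /=.
  have [le eq] := objective_ge m_gt0 D0 pS pK; apply/eq/le_anti.
  by rewrite le minK.
have pK : posdef K by case: rK => c c0 ->; apply: posdefZ.
split=> // L pL; have [_ [_ ->]] := objective_ge m_gt0 D0 pS pK => //.
by have [] := objective_ge m_gt0 D0 pS pL.
Qed.

(** * Existence and uniqueness of the Kronecker MLE *)

Lemma tensmxZ (R : comPzRingType) m n p q (c d : R) (A : 'M[R]_(m, n))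
    (B : 'M[R]_(p, q)) :
  tensmx (c *: A) (d *: B) = (c * d) *: tensmx A B.
Proof. by apply/matrixP=> i j; rewrite !mxE mulrACA. Qed.

(** The bounds in [K1] and in [K2] are chained. A second maximizer attains both, so its factors
    agree with [K1 S] and [S] up to inverse scalars. *)
Lemma kronecker_mle_unique (R : realType) n m1 m2 (e : (m1 + 1 = n * m2)%N)
    (Y : sample R n m1 m2) (D : 'M[R]_(n * m2, 1)) :
  (0 < n)%N -> (0 < m2)%N -> row_free (concat_sample Y) ->
  concat_sample Y *m D = 0 -> D != 0 -> posdef (Dblock D 0 0) ->
  kronecker_mle_exists_uniquely Y.
Proof.
move=> n_gt0 m2_gt0 fY YD0 D0 pS.
set S := Dblock D 0 0 in pS *.
have profile := loglik_le_profile e n_gt0 m2_gt0 fY YD0 D0.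
have nR : 0 < n%:R :> R by rewrite ltr0n.
pose K1 K2 := (n * m2)%:R *: invmx (scatter Y K2).
have pK1 K2 : posdef K2 -> posdef (K1 K2).
  move=> pK; apply: posdefZ; first by rewrite ltr0n muln_gt0 n_gt0.
  by apply/posdef_inv/(scatter_posdef fY).
have maxS L1 L2 : posdef L1 -> posdef L2 ->
    loglik Y L1 L2 <= loglik Y (K1 S) S.
  move=> p1 p2; have [le _] := profile _ _ p1 p2; apply: (le_trans le).
  have [_ [_ ->]] := profile _ _ (pK1 S pS) pS => //.
  rewrite lerD2l lerN2 ler_pM2l //.
  by have [] := objective_ge m2_gt0 D0 pS p2.
exists (tensmx S (K1 S)); split.
  by exists (K1 S), S; split=> //; exact: pK1.
move=> _ [L1 [L2 [p1 p2 -> maxL]]].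
have eqL : loglik Y L1 L2 = loglik Y (K1 S) S.
  by apply/le_anti; rewrite maxS // maxL //; exact: pK1.
have [leL eqL1] := profile _ _ p1 p2.
have [leS eqS] := objective_ge m2_gt0 D0 pS p2.
have [_ [_ valS]] := profile _ _ (pK1 S pS) pS.
have {}valS := valS erefl.
have leS' : n%:R * objective D S <= n%:R * objective D L2 by rewrite ler_pM2l.
have eqO : n%:R * objective D L2 = n%:R * objective D S.
  by move: leL leS'; rewrite eqL valS; lra.
have [c c0 eL2] : pos_ray S L2.
  by apply/eqS; apply: (mulfI _ eqO); rewrite gt_eqF.
have eL1 : L1 = K1 L2 by apply/eqL1; rewrite eqL valS eqO.
(* The scatter matrix is linear in [K2], so the factor [c] on [S] is cancelled by [c^-1] on the
   other Kronecker factor. *)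
have -> : L1 = c^-1 *: K1 S.
  have scat : scatter Y (c *: S) = c *: scatter Y S.
    rewrite /scatter -[X in tensmx X (c *: _)]scale1r tensmxZ mul1r.
    by rewrite -scalemxAr -scalemxAl.
  rewrite eL1 /K1 eL2 scat invmxZ; last first.
    by rewrite unitmxZ ?unitfE ?gt_eqF // posdef_unit //; apply: scatter_posdef.
  by rewrite !scalerA mulrC.
by rewrite eL2 tensmxZ mulfV ?gt_eqF // scale1r.
Qed.

(** * Nonexistence for [n < m2] *)

(** For [L = K + u u^T], the trace of [K L^-1] is [m - u^T L^-1 u], so its log-determinant is
    negative by [ln_detM_le_trace]. *)
Lemma posdef_add_rank1 (R : realType) m (K : 'M[R]_m) (u : 'cV[R]_m) :
  posdef K -> u != 0 ->
  posdef (K + u *m u^T) /\ ln (\det K) < ln (\det (K + u *m u^T)).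
Proof.
move=> pK u0.
have pL : posdef (K + u *m u^T).
  apply: posdefD => // [|v]; first by rewrite trmx_mul trmxK.
  rewrite mulmxA -mulmxA -[v^T *m u]trmxK trmx_mul trmxK.
  exact: cVnorm_ge0.
split=> //; set L := K + _ in pL *.
have [le _] := ln_detM_le_trace pK (posdef_inv pL).
have [_ /(_ u u0) q0] := posdef_inv pL.
move: le; rewrite det_mulmx lnM ?posrE ?posdef_det_gt0 //; last exact: posdef_inv.
rewrite det_inv lnV ?posrE ?posdef_det_gt0 //.
have -> : \tr (K *m invmx L) = m%:R - (u^T *m invmx L *m u) 0 0.
  rewrite -[K](addrK (u *m u^T)) -/L mulmxBl mulmxV ?posdef_unit //.
  rewrite linearB /= mxtrace1; congr (_ - _).
  by rewrite -[in LHS]mulmxA [in LHS]mxtrace_mulC trace_mx11.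
by lra.
Qed.

Lemma row_nfree_kernel (R : fieldType) p q (A : 'M[R]_(p, q)) :
  ~~ row_free A -> exists2 u : 'cV[R]_p, u != 0 & u^T *m A = 0.
Proof.
rewrite -kermx_eq0 => /rowV0Pn [v /sub_kermxP vA v0].
by exists v^T; rewrite ?trmxK // trmx_eq0.
Qed.

Lemma no_kronecker_mle (R : realType) n m1 m2 (e : (m1 + 1 = n * m2)%N)
    (Y : sample R n m1 m2) (K : 'M[R]_(m2 * m1)) :
  (0 < n)%N -> (0 < m2)%N -> (n < m2)%N -> ~ is_kronecker_mle Y K.
Proof.
move=> n_gt0 m2_gt0 lt_nm2 [K1 [K2 [p1 p2 _ maxK]]].
have NR : 0 < (n * m2)%:R :> R by rewrite ltr0n muln_gt0 n_gt0.
have nR : 0 < n%:R :> R by rewrite ltr0n.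
have [fY|/row_nfree_kernel [u u0 uY]] :=
  boolP (row_free (concat_sample Y)); last first.
  (* For data of deficient row rank, adding [u u^T] to [K1] preserves the trace term and raises the
     determinant. *)
  have [pL ltL] := posdef_add_rank1 p1 u0.
  have uS : u *m u^T *m scatter Y K2 = 0.
    by rewrite /scatter !mulmxA -(mulmxA u) uY mulmx0 !mul0mx.
  have := maxK _ _ pL p2; rewrite !loglikE mulmxDl uS addr0.
  by rewrite lerD2r lerD2r ler_pM2l // leNgt ltL.
(* The leading block of an arbitrary sample may be singular, so [D] is taken as any nonzero kernel
   vector instead of [Dmx]. *)
have nfree : ~~ row_free (concat_sample Y)^T.
  rewrite /row_free mxrank_tr neq_ltn; apply/orP; left.
  have lt_m1 : (m1 < n * m2)%N by rewrite -e addn1.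
  exact: leq_ltn_trans (rank_leq_row _) lt_m1.
have [D D0 YD0'] := row_nfree_kernel nfree.
have YD0 : concat_sample Y *m D = 0.
  by apply: trmx_inj; rewrite trmx_mul YD0' trmx0.
(* The columns of [W] are the [d_i], too few to span the space of dimension [m2]. *)
pose W : 'M[R]_(m2, n) := \matrix_(r, i) D (mxtens_index (i, r)) 0.
have nfreeW : ~~ row_free W.
  rewrite /row_free neq_ltn; apply/orP; left.
  exact: leq_ltn_trans (rank_leq_col _) lt_nm2.
have [v v0 vW] := row_nfree_kernel nfreeW.
have vD i : v^T *m dvec D i 0 = 0.
  apply/matrixP=> a b; transitivity ((v^T *m W) a i); last by rewrite vW !mxE.
  by rewrite mxE [RHS]mxE; apply: eq_bigr => r _; rewrite !mxE.
have vS : \tr (Dblock D 0 0 *m (v *m v^T)) = 0.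
  rewrite mulmx_suml raddf_sum big1 // => i _ /=.
  by rewrite mxtrace_mulC mulmxA -[v *m v^T *m _]mulmxA vD mulmx0 mul0mx raddf0.
have [pL ltL] := posdef_add_rank1 (posdef_inv p2) v0.
pose L2 := invmx (invmx K2 + v *m v^T).
have pL2 : posdef L2 by apply: posdef_inv.
have profile := loglik_le_profile e n_gt0 m2_gt0 fY YD0 D0.
(* With the optimal partner of [L2] the profile bound is attained, and it exceeds the bound at
   [K2]. *)
pose L1 := (n * m2)%:R *: invmx (scatter Y L2).
have pL1 : posdef L1 by apply/posdefZ/posdef_inv/(scatter_posdef fY).
have [_ [_ valL]] := profile _ _ pL1 pL2.
have [leK _] := profile _ _ p1 p2.
have ltO : objective D L2 < objective D K2.
  rewrite !objectiveE /L2 invmxK mulmxDr mxtraceD vS addr0 ltrD2l det_inv.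
  rewrite lnV ?posrE ?posdef_det_gt0 // ltrNl.
  by rewrite -lnV ?posrE ?posdef_det_gt0 // -det_inv.
have := maxK _ _ pL1 pL2; rewrite (valL erefl) => /le_trans /(_ leK).
by rewrite lerD2l lerN2 ler_pM2l // leNgt ltO.
Qed.

(** * The likelihood equations *)

Section MLPoints.
Variables (R : realType) (n m : nat) (D : 'M[R]_(n * m, 1)).

(** For [k = 1] only the identity permutation and an empty product remain. *)
Lemma likelihood_equations1 (S : 'M[complex R]_m) :
  likelihood_equations D S <->
  (m%:R * \det S) *: DblockC D 0 0 = \tr (DblockC D 0 0 *m S) *: \adj S.
Proof.
have S1 (s : 'S_1) : s = 1%g by apply/permP=> i; rewrite !ord1.
rewrite /likelihood_equations (big_pred1 1%g); last first.
  by move=> s; apply/esym/eqP.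
rewrite odd_perm1 expr0 scale1r big_ord1 big_pred0 ?scale1r; last first.
  by move=> a; rewrite ord1.
by rewrite perm1 mul1r det_mx11 mxE.
Qed.

Lemma proj_classZ (S : 'M[complex R]_m) (c : complex R) :
  c != 0 -> proj_class (c *: S) = proj_class S.
Proof.
move=> c0; apply/seteqP; split=> _ [d d0 ->].
  by exists (d * c); rewrite ?mulf_neq0 // scalerA.
by exists (d / c); rewrite ?mulf_neq0 ?invr_eq0 // scalerA divfK.
Qed.

(** Multiplying the equation by [S] turns the adjugate into [\det S]; cancelling it leaves [SC *m S]
    scalar, so the only point is the class of [invmx SC]. *)
Lemma ml_points_unique : (0 < m)%N -> posdef (Dblock D 0 0) ->
  (ml_points D #= `I_1)%card.
Proof.
move=> m_gt0 pS; set SC := DblockC D 0 0.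
have uC : SC \in unitmx by rewrite map_unitmx posdef_unit.
have sC : SC^T = SC by rewrite /SC /DblockC map_trmx; case: pS => ->.
have mC : m%:R != 0 :> complex R by rewrite pnatr_eq0 -lt0n.
have -> : ml_points D = [set proj_class (invmx SC)]%classic; last exact: card_set1.
apply/seteqP; split=> [_ [S [symS S0 dS tS lik] <-]|_ ->] /=.
  move/likelihood_equations1: lik => lik.
  rewrite det_mx11 mxE -/SC in tS lik *.
  have eS : S = (\tr (SC *m S) / m%:R) *: invmx SC.
    apply: (can_inj (mulKmx uC)); rewrite -scalemxAr mulmxV //.
    apply: (scalerI (mulf_neq0 mC dS)).
    rewrite scalemxAl lik -scalemxAl mul_adj_mx !scale_scalar_mx.
    by rewrite mulr1 [_ / _]mulrC mulrACA mulfV // mul1r mulrC.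
  by rewrite eS proj_classZ // mulf_neq0 ?invr_eq0.
have uV : invmx SC \in unitmx by rewrite unitmx_inv.
have dV : \det (invmx SC) != 0 by rewrite -unitfE -unitmxE.
have tV : \tr (SC *m invmx SC) = m%:R by rewrite mulmxV // mxtrace1.
exists (invmx SC) => //; split=> //.
- by rewrite trmx_inv sC.
(* A zero matrix has zero determinant only in positive size. *)
- by apply: contraNneq dV => ->; case: (m) m_gt0 => // k _; rewrite det0.
- by rewrite det_mx11 mxE tV.
apply/likelihood_equations1; rewrite -/SC tV -scalerA; congr (_ *: _).
rewrite -[RHS]mul1mx -(mulmxV uC) -mulmxA mul_mx_adj mul_mx_scalar.
by [].
Qed.

End MLPoints.

(** * Genericity *)

Section PolynomialFunctions.
Variables (R : realType) (N : nat).
Implicit Types f g : ('I_N -> R) -> R.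

(** Working with evaluation functions gives closure under sums, products and determinants without
    explicit polynomials. *)
Definition polyfun f := exists p : mpoly.mpoly N R,
  forall y, mpoly.meval y p = f y.

Lemma eq_polyfun f g : f =1 g -> polyfun f -> polyfun g.
Proof. by move=> fg [p pf]; exists p => y; rewrite pf fg. Qed.

Lemma polyfun_cst c : polyfun (fun=> c).
Proof. by exists (mpoly.mpolyC N c) => y; rewrite mpoly.mevalC. Qed.

Lemma polyfun_coord i : polyfun (fun y => y i).
Proof. by exists (mpoly.mpolyX R (mpoly.mnm1 i)) => y; rewrite mpoly.mevalXU. Qed.

Lemma polyfunD f g : polyfun f -> polyfun g -> polyfun (fun y => f y + g y).
Proof. by move=> [p pf] [q qg]; exists (p + q) => y; rewrite mpoly.mevalD pf qg. Qed.

Lemma polyfunM f g : polyfun f -> polyfun g -> polyfun (fun y => f y * g y).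
Proof. by move=> [p pf] [q qg]; exists (p * q) => y; rewrite mpoly.mevalM pf qg. Qed.

Lemma polyfun_sum (I : Type) (r : seq I) (P : pred I) (F : I -> _ -> R) :
  (forall i, polyfun (F i)) -> polyfun (fun y => \sum_(i <- r | P i) F i y).
Proof.
move=> pF; elim: r => [|i r IH].
  by apply: eq_polyfun (polyfun_cst 0) => y; rewrite big_nil.
case: (boolP (P i)) => Pi; last first.
  by apply: eq_polyfun IH => y; rewrite big_cons (negPf Pi).
by apply: eq_polyfun (polyfunD (pF i) IH) => y; rewrite big_cons Pi.
Qed.

Lemma polyfun_prod (I : Type) (r : seq I) (P : pred I) (F : I -> _ -> R) :
  (forall i, polyfun (F i)) -> polyfun (fun y => \prod_(i <- r | P i) F i y).
Proof.
move=> pF; elim: r => [|i r IH].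
  by apply: eq_polyfun (polyfun_cst 1) => y; rewrite big_nil.
case: (boolP (P i)) => Pi; last first.
  by apply: eq_polyfun IH => y; rewrite big_cons (negPf Pi).
by apply: eq_polyfun (polyfunM (pF i) IH) => y; rewrite big_cons Pi.
Qed.

Definition polymx m p (F : ('I_N -> R) -> 'M[R]_(m, p)) :=
  forall i j, polyfun (fun y => F y i j).

Lemma polymx_mul m p q (F : _ -> 'M[R]_(m, p)) (G : _ -> 'M[R]_(p, q)) :
  polymx F -> polymx G -> polymx (fun y => F y *m G y).
Proof.
move=> pF pG i j.
have h : polyfun (fun y => \sum_k F y i k * G y k j).
  by apply: polyfun_sum => k; apply: polyfunM.
by apply: eq_polyfun h => y; rewrite mxE.
Qed.

Lemma polyfun_det m (F : _ -> 'M[R]_m) :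
  polymx F -> polyfun (fun y => \det (F y)).
Proof.
move=> pF; apply: polyfun_sum => s; apply: polyfunM; first exact: polyfun_cst.
by apply: polyfun_prod => i; apply: pF.
Qed.

Lemma polymx_adj m (F : _ -> 'M[R]_m) :
  polymx F -> polymx (fun y => \adj (F y)).
Proof.
move=> pF i j.
have h : polyfun (fun y => (-1) ^+ (j + i) * \det (row' j (col' i (F y)))).
  apply: polyfunM; first exact: polyfun_cst.
  apply: polyfun_det => r s; apply: eq_polyfun (pF (lift j r) (lift i s)) => y.
  by rewrite !mxE.
by apply: eq_polyfun h => y; rewrite mxE.
Qed.

(** The variety is the hypersurface [f = 0], proper because it misses [y0]. *)
Lemma generically_polyfun f (P : ('I_N -> R) -> Prop) y0 :
  polyfun f -> f y0 != 0 -> (forall y, f y != 0 -> P y) -> generically P.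
Proof.
move=> [p pf] f0 fP; exists [set p]%classic; split.
  apply/eqP=> /seteqP [_ /(_ y0 Logic.I) h].
  by have := h p erefl; rewrite pf => /eqP; apply/negP.
move=> y ny; apply: fP; apply/eqP=> fy0; apply: ny => _ ->.
by rewrite pf.
Qed.

End PolynomialFunctions.

(** * The kernel vector and its polynomial multiple *)

Section KernelVector.
Variables (R : realType) (p N : nat) (e : (p + 1 = N)%N) (Z : 'M[R]_(p, N)).
Let Z' : 'M[R]_(p, p + 1) := castmx (erefl, esym e) Z.

Lemma row_free_lsubmx : lsubmx Z' \in unitmx -> row_free Z.
Proof.
rewrite /Z'; case: N / e Z => Z0; rewrite castmx_id => u.
apply/row_freeP; exists (col_mx (invmx (lsubmx Z0)) 0).
by rewrite -{1}[Z0]hsubmxK mul_row_col mulmx0 addr0 mulmxV.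
Qed.

(** This is [Dmx] for [k = 1], over a variable size [N] so that the cast along [e] can be
    eliminated. *)
Definition kernel_vec : 'M[R]_(N, 1) :=
  castmx (e, erefl) (col_mx (rsubmx (invmx (lsubmx Z') *m Z')) (- 1%:M)).

(** The kernel vector with denominators cleared, so that its entries are polynomials in those of
    [Z]. *)
Definition adj_kernel_vec : 'M[R]_(N, 1) :=
  castmx (e, erefl)
    (col_mx (rsubmx (\adj (lsubmx Z') *m Z')) (- (\det (lsubmx Z'))%:M)).

Lemma mul_kernel_vec : lsubmx Z' \in unitmx -> Z *m kernel_vec = 0.
Proof.
rewrite /kernel_vec /Z'; case: N / e Z => Z0; rewrite !castmx_id => u.
rewrite -{1}[Z0]hsubmxK mul_row_col -{3}[Z0]hsubmxK mul_mx_row row_mxKr.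
by rewrite mulKVmx // mulmxN mulmx1 subrr.
Qed.

Lemma kernel_vec_neq0 : kernel_vec != 0.
Proof.
rewrite /kernel_vec; case: N / e; rewrite castmx_id; apply/eqP => /matrixP.
move=> /(_ (rshift p 0) 0); rewrite col_mxEd !mxE => /eqP.
by rewrite oppr_eq0 oner_eq0.
Qed.

Lemma adj_kernel_vecE : lsubmx Z' \in unitmx ->
  adj_kernel_vec = \det (lsubmx Z') *: kernel_vec.
Proof.
rewrite /adj_kernel_vec /kernel_vec => u.
have d0 : \det (lsubmx Z') != 0 by rewrite -unitfE -unitmxE.
case: N / e; rewrite !castmx_id scale_col_mx scalerN scale_scalar_mx mulr1.
congr col_mx; rewrite -linearZ /= scalemxAl; congr (rsubmx (_ *m _)).
by rewrite /invmx u scalerA mulfV // scale1r.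
Qed.

End KernelVector.

Lemma DmxE (R : realType) n m1 m2 (e : (m1 + 1 = n * m2)%N)
    (Y : sample R n m1 m2) : Dmx e Y = kernel_vec e (concat_sample Y).
Proof. by []. Qed.

Lemma DblockZ (R : realType) n m (c : R) (D : 'M[R]_(n * m, 1)) :
  Dblock (c *: D) 0 0 = c ^+ 2 *: Dblock D 0 0.
Proof.
rewrite scaler_sumr; apply: eq_bigr => i _; apply/matrixP => r s.
by rewrite !mxE !big_ord1 !mxE mulrACA expr2.
Qed.

(** [S] is the Gram matrix [W^T W] of the matrix with rows [d_i^T], and invertibility makes [W]
    injective. A single determinant thus tests positive definiteness. *)
Lemma posdef_Dblock (R : realType) n m (D : 'M[R]_(n * m, 1)) :
  Dblock D 0 0 \in unitmx -> posdef (Dblock D 0 0).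
Proof.
move=> u; set W : 'M[R]_(n, m) := \matrix_(i, r) D (mxtens_index (i, r)) 0.
have eS : Dblock D 0 0 = W^T *m 1%:M *m W.
  rewrite mulmx1; apply/matrixP => r s; rewrite summxE mxE; apply: eq_bigr => i _.
  by rewrite !mxE big_ord1 !mxE.
rewrite eS in u *; apply: posdef_congr; first exact: posdef1.
by move=> v Wv0; rewrite -[v](mulKmx u) -!mulmxA Wv0 !mulmx0.
Qed.

(** * Nondegenerate samples *)

Section Nondegenerate.
Variables (R : realType) (n m1 m2 : nat) (e : (m1 + 1 = n * m2)%N).

Definition lead_block (Y : sample R n m1 m2) : 'M[R]_m1 :=
  lsubmx (castmx (erefl, esym e) (concat_sample Y) : 'M[R]_(m1, m1 + 1)).

(* Clearing denominators in the Gram matrix of D by means of the adjugate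
   makes the nondegeneracy conditions polynomial in the data. *)
Definition nondeg (Y : sample R n m1 m2) : R :=
  \det (lead_block Y) * \det (Dblock (adj_kernel_vec e (concat_sample Y)) 0 0).

Lemma nondegP (Y : sample R n m1 m2) : nondeg Y != 0 ->
  [/\ row_free (concat_sample Y), concat_sample Y *m Dmx e Y = 0,
      Dmx e Y != 0 & posdef (Dblock (Dmx e Y) 0 0)].
Proof.
rewrite mulf_eq0 negb_or -!unitfE -!unitmxE => /andP[uY uS]; split.
- exact: row_free_lsubmx uY.
- by rewrite DmxE mul_kernel_vec.
- by rewrite DmxE kernel_vec_neq0.
apply: posdef_Dblock; move: uS; rewrite adj_kernel_vecE // DblockZ.
by rewrite -DmxE unitmxZ // unitrX // -unitmxE.
Qed.

Lemma polyfun_nondeg :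
  polyfun (fun y : 'I_(n * (m1 * m2)) -> R => nondeg (sample_of_point y)).
Proof.
have pZ : polymx (fun y : 'I_(n * (m1 * m2)) -> R =>
    castmx (erefl, esym e) (concat_sample (sample_of_point y))
      : 'M[R]_(m1, m1 + 1)).
  move=> i j; set l := cast_ord (esym (esym e)) j.
  apply: eq_polyfun (polyfun_coord R
    (mxtens_index ((mxtens_unindex l).1,
                   mxtens_index (i, (mxtens_unindex l).2)))) => y.
  by rewrite castmxE !mxE cast_ord_id.
have pL : polymx (fun y : 'I_(n * (m1 * m2)) -> R =>
    lead_block (sample_of_point y)).
  by move=> i j; apply: eq_polyfun (pZ i (lshift 1 j)) => y; rewrite [RHS]mxE.
apply: polyfunM; first exact: polyfun_det.
apply: polyfun_det => r s.
have pA : polymx (fun y : 'I_(n * (m1 * m2)) -> R =>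
    adj_kernel_vec e (concat_sample (sample_of_point y))).
  move=> l j; rewrite (ord1 j).
  case: (split_ordP (cast_ord (esym e) l)) => k ek.
    apply: eq_polyfun (polymx_mul (polymx_adj pL) pZ k (rshift m1 0)) => y.
    by rewrite castmxE ek col_mxEu cast_ord_id [RHS]mxE.
  apply: eq_polyfun (polyfunM (polyfun_cst _ (-1)) (polyfun_det pL)) => y.
  rewrite castmxE ek col_mxEd cast_ord_id mxE mxE !ord1 eqxx mulr1n.
  by rewrite mulN1r.
have pS : polyfun (fun y : 'I_(n * (m1 * m2)) -> R => \sum_(i < n)
    adj_kernel_vec e (concat_sample (sample_of_point y)) (mxtens_index (i, r)) 0
    * adj_kernel_vec e (concat_sample (sample_of_point y)) (mxtens_index (i, s)) 0).
  by apply: polyfun_sum => i; apply: polyfunM; apply: pA.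
apply: eq_polyfun pS => y; rewrite summxE; apply: eq_bigr => i _.
by rewrite [RHS]mxE big_ord1 !mxE.
Qed.

(* The witness has Ystar = I and D equal to minus the indicator of the
   entries (n - m2 + r, r), so that the d_i run over the basis vectors. *)
Lemma nondeg_witness : (0 < m2)%N -> (m2 <= n)%N ->
  exists y : 'I_(n * (m1 * m2)) -> R, nondeg (sample_of_point y) != 0.
Proof.
move=> m2_gt0 le_mn.
pose D0 : 'M[R]_(n * m2, 1) := \matrix_(l, j)
  - ((mxtens_unindex l).1 == (n - m2 + (mxtens_unindex l).2)%N :> nat)%:R.
pose D1 : 'M[R]_(m1 + 1, 1) := castmx (esym e, erefl) D0.
(* The last index is [(n-1) m2 + (m2-1)]: block [n-1], position [m2-1]. Its entry is [-1] since
   [n - m2 + (m2-1) = n-1], as the shape of [D] requires. *)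
have dD1 : dsubmx D1 = - 1%:M.
  apply/matrixP => i j; rewrite !ord1 !mxE castmxE !mxE /=.
  have -> : (m1 + 0 = n.-1 * m2 + m2.-1)%N.
    have n_gt0 : (0 < n)%N by exact: leq_trans le_mn.
    have := e; rewrite -{1}(prednK n_gt0) mulSn => e'.
    by rewrite addn0; apply: (@addIn 1); rewrite e' addn1 -addnS prednK // addnC.
  rewrite divnMDl // modnMDl divn_small ?modn_small ?prednK // addn0.
  have -> : (n - m2 + m2.-1 = n.-1)%N by rewrite -subn1 addnBA // subnK // subn1.
  by rewrite eqxx.
pose Z : 'M[R]_(m1, n * m2) := castmx (erefl, e) (row_mx 1%:M (usubmx D1)).
pose y (l : 'I_(n * (m1 * m2))) : R :=
  let u := mxtens_unindex l in let v := mxtens_unindex u.2 in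
  Z v.1 (mxtens_index (u.1, v.2)).
have yZ : concat_sample (sample_of_point y) = Z.
  apply/matrixP => i l; rewrite [LHS]mxE [LHS]mxE /y !mxtens_indexK /=.
  exact: (congr1 (Z i) (mxtens_unindexK l)).
have castZ : castmx (erefl, esym e) Z = row_mx 1%:M (usubmx D1)
    :> 'M[R]_(m1, m1 + 1).
  by rewrite /Z castmx_comp castmx_id.
exists y; rewrite /nondeg /lead_block /adj_kernel_vec yZ castZ.
rewrite row_mxKl det1 mul1r.
rewrite adj1 mul1mx row_mxKr -dD1 vsubmxK /D1 castmx_comp castmx_id.
suff -> : Dblock D0 0 0 = 1%:M by rewrite det1 oner_eq0.
apply/matrixP => r s; rewrite summxE mxE.
(* Only block [n - m2 + r] has a nonzero entry at position [r]; the truncated subtraction is exact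
   because [m2 <= n]. *)
have lt_n : (n - m2 + r < n)%N.
  by rewrite -[X in (_ < X)%N](subnK le_mn) ltn_add2l.
rewrite (bigD1 (Ordinal lt_n)) //= big1 => [|i ni].
  by rewrite mxE big_ord1 !mxE !mxtens_indexK /= eqxx mulrNN mul1r eqn_add2l addr0.
rewrite mxE big_ord1 !mxE !mxtens_indexK /=.
by move: ni; rewrite -val_eqE /= => /negPf ->; rewrite oppr0 mul0r.
Qed.

Lemma generic_nondeg (P : sample R n m1 m2 -> Prop) :
  (0 < m2)%N -> (m2 <= n)%N ->
  (forall Y, nondeg Y != 0 -> P Y) -> generic_sample P.
Proof.
move=> m2_gt0 le_mn hP; have [y0 ny0] := nondeg_witness m2_gt0 le_mn.
by apply: (generically_polyfun polyfun_nondeg ny0) => y; apply: hP.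
Qed.

End Nondegenerate.

Lemma generic_sample_all (R : realType) n m1 m2 (P : sample R n m1 m2 -> Prop) :
  (forall Y, P Y) -> generic_sample P.
Proof.
move=> hP; apply: (@generically_polyfun R _ (fun=> 1) _ (fun=> 0)).
  exact: polyfun_cst.
  exact: oner_neq0.
by move=> y _; exact: hP.
Qed.

(** A proper variety has a point outside it. Generic existence of the MLE thereby yields one sample
    that has an MLE. *)
Lemma generic_sample_ex (R : realType) n m1 m2 (P : sample R n m1 m2 -> Prop) :
  generic_sample P -> exists Y, P Y.
Proof.
case=> S [/eqP nS hS]; apply: contrapT => nP; apply: nS.
apply/seteqP; split=> // y _; apply: contrapT => ny.
by apply: nP; exists (sample_of_point y); apply: hS.
Qed.

Theorem theorem3p4 (R : realType) (m1 m2 n : nat)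
    (m1_gt0 : (0 < m1)%N) (m2_gt0 : (0 < m2)%N) (n_gt0 : (0 < n)%N)
    (e : (m1 + 1 = n * m2)%N) :
  [/\ generic_sample (@kronecker_mle_exists_uniquely R n m1 m2)
        <-> (m2 <= n)%N,
      generic_sample (fun Y : sample R n m1 m2 =>
        kronecker_mle_exists_uniquely Y <-> (m2 <= n)%N),
      (m2 <= n)%N -> generic_sample (fun Y : sample R n m1 m2 =>
        let D := Dmx e Y in
        unique_minimizer_up_to_scaling (objective D)
          (\sum_(i < n) dvec D i ord0 *m (dvec D i ord0)^T))
    & (m2 <= n)%N -> @ml_degree_eq R n m1 m2 1 e 1].
Proof.
have mle (Y : sample R n m1 m2) :
    nondeg e Y != 0 -> kronecker_mle_exists_uniquely Y.
  move=> /nondegP [fY YD0 D0 pS].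
  exact: (kronecker_mle_unique e n_gt0 m2_gt0 fY YD0 D0 pS).
have no_mle (Y : sample R n m1 m2) :
    (n < m2)%N -> ~ kronecker_mle_exists_uniquely Y.
  by move=> lt_nm [K [hK _]]; exact: (no_kronecker_mle e n_gt0 m2_gt0 lt_nm hK).
split.
- split=> [/generic_sample_ex [Y hY]|le_mn].
    by rewrite leqNgt; apply/negP => /(no_mle Y); apply.
  exact: generic_nondeg le_mn mle.
(* For [n < m2] both sides of the equivalence fail for every sample, so it holds without
   exception. *)
- case: (leqP m2 n) => [le_mn|lt_nm].
    by apply: (generic_nondeg (e := e)) => // Y /mle.
  by apply: generic_sample_all => Y; split=> // /(no_mle _ lt_nm).
- move=> le_mn; apply: (generic_nondeg (e := e)) => // Y /nondegP [_ _ D0 pS] D.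
  exact: unique_minimizer_Dblock.
move=> le_mn; apply: (generic_nondeg (e := e)) => // Y /nondegP [_ _ _ pS].
exact: ml_points_unique.
Qed.
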